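(* The sentence $\Phi(256)$ is true.
   Context: Define $f:\mathbb{N}\setminus\{0\}\to\mathbb{N}\setminus\{0\}$ by $f(1)=1$, $f(n)=2^{2^{n-2}}$ for $n\in\{2,3,4,5\}$, and $f(n)=\left(2+2^{2^{n-4}}\right)^{2^{n-4}}$ for $n\geqslant 6$. For a positive integer $b$, $\Phi(b)$ is the sentence: for every positive integer $n$ and every system $T\subseteq\{x_i+1=x_k,\ x_i\cdot x_j=x_k:\ i,j,k\in\{1,\ldots,n\}\}$ all of whose solutions $(x_1,\ldots,x_n)$ in positive integers satisfy $x_1,\ldots,x_n\leqslant b$, each such solution satisfies $x_1,\ldots,x_n\leqslant f(n)$. *)

(* Defs.v *)
From mathcomp Require Import all_boot.

Set Implicit Arguments.
Unset Strict Implicit.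
Unset Printing Implicit Defensive.

(* Only the values at n >= 1 are meaningful; f 0 is a junk value. *)
Definition f (n : nat) : nat :=
  if n == 1 then 1
  else if n <= 5 then 2 ^ (2 ^ (n - 2))
  else (2 + 2 ^ (2 ^ (n - 4))) ^ (2 ^ (n - 4)).

(* [SuccEq i k] stands for x_i + 1 = x_k, [MulEq i j k] for x_i * x_j = x_k;
   the indices 1, ..., n are represented by 'I_n. *)
Inductive equation (n : nat) : Type :=
  | SuccEq of 'I_n & 'I_n
  | MulEq of 'I_n & 'I_n & 'I_n.

Definition holds (n : nat) (x : 'I_n -> nat) (e : equation n) : Prop :=
  match e with
  | SuccEq i k => x i + 1 = x k
  | MulEq i j k => x i * x j = x k
  end.

Definition solution (n : nat) (T : pred (equation n)) (x : 'I_n -> nat) : Prop :=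
  (forall i, 0 < x i) /\ (forall e, T e -> holds x e).

Definition Phi (b : nat) : Prop :=
  forall (n : nat) (T : pred (equation n)), 0 < n ->
    (forall x, solution T x -> forall i, x i <= b) ->
    forall x, solution T x -> forall i, x i <= f n.

(* Main.v *)
(* A solution takes at most n distinct values. Whether a map of this value set
   into the positive integers yields another solution depends only on the
   relations u + 1 = v and u * v = w that hold between the values. When n <= 4
   and the largest value exceeds f n, the set always belongs to an infinite
   family with the same relations: some value can be moved freely or serve as
   the parameter of a polynomial family, or there is no relation u + 1 = v, and
   then raising all values to a fixed power works. Hence some solution exceeds
   256. For n >= 5 we have 256 <= f n. *)
Require Import Defs.
From mathcomp Require Import all_boot zify.

(* [nia] does not find this, as X^2 - X - 1 has a real root above 1. *)
Lemma sqr_neq_succ a : a * a <> a + 1.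
Proof. by case: a => [|[|a]] //; nia. Qed.

(** * Chains of two, three and four values *)

Ltac transfer2 H p q :=
  suff: q <= 256 by [lia]; apply: (H p q); intros; subst; nia.

(** In an increasing chain only neighbours can differ by 1, only the least value can be 1, and a
    product of factors above 1 exceeds both. So the listed implications cover every relation. The
    new values need not be increasing. *)
Lemma chain2_bound a b : 0 < a -> a < b ->
  (forall a' b', 0 < a' -> 0 < b' -> (a = 1 -> a' = 1) ->
     (a + 1 = b -> a' + 1 = b') -> (a * a = b -> a' * a' = b') -> b' <= 256) ->
  b <= 2.
Proof.
move=> a0 ab H; case: (leqP b 2) => // b2; exfalso.
case: (eqVneq (a + 1) b) => ?; first by transfer2 H (a + 256) (a + 257).
(* 17 is the least number whose square exceeds 256. *)
case: (eqVneq (a * a) b) => ?; first by transfer2 H 17 289.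
by transfer2 H a 257.
Qed.

Ltac transfer3 H p q r :=
  suff: r <= 256 by [nia]; apply: (H p q r); intros; subst; nia.

Lemma chain3_bound a b c : 0 < a -> a < b -> b < c ->
  (forall a' b' c', 0 < a' -> 0 < b' -> 0 < c' -> (a = 1 -> a' = 1) ->
     (a + 1 = b -> a' + 1 = b') -> (b + 1 = c -> b' + 1 = c') ->
     (a * a = b -> a' * a' = b') -> (a * a = c -> a' * a' = c') ->
     (a * b = c -> a' * b' = c') -> (b * b = c -> b' * b' = c') -> c' <= 256) ->
  c <= 4.
Proof.
move=> a0 ab bc H; case: (leqP c 4) => // c4; exfalso.
case: (eqVneq (a + 1) b) => ab1; case: (eqVneq (b + 1) c) => bc1.
(* Here [a >= 3], so all products exceed [c] and the chain can be shifted. *)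
- by transfer3 H (a + 256) (a + 257) (a + 258).
- case: (eqVneq (a * a) c) => ?; first by transfer3 H 17 18 289.
  case: (eqVneq (a * b) c) => ?; first by transfer3 H 17 18 306.
  case: (eqVneq (b * b) c) => ?.
    by have aa := @sqr_neq_succ a; transfer3 H 17 18 324.
  by transfer3 H a b 257.
- case: (eqVneq (a * a) b) => ?; first by transfer3 H 17 289 290.
  case: (eqVneq (a * a) c) => ?; first by transfer3 H 17 288 289.
  by transfer3 H a 257 258.
(* As [4 ^ 4 = 256], fourth powers carry any [c > 4] past the bound. *)
suff: c ^ 4 <= 256 by move: c4; clear; rewrite (leq_exp2r _ 4) //; lia.
by apply: (H (a ^ 4) (b ^ 4)); rewrite ?expn_gt0 ?a0 //; lia.
Qed.

Ltac transfer4 H p q r s :=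
  suff: s <= 256 by [nia]; apply: (H p q r s); intros; subst; nia.

Ltac if_mul4 x y z H p q r s :=
  case: (eqVneq (x * y) z) => ?; first by transfer4 H p q r s.

Lemma chain4_bound a b c d : 0 < a -> a < b -> b < c -> c < d ->
  (forall a' b' c' d', 0 < a' -> 0 < b' -> 0 < c' -> 0 < d' -> (a = 1 -> a' = 1) ->
     (a + 1 = b -> a' + 1 = b') -> (b + 1 = c -> b' + 1 = c') ->
     (c + 1 = d -> c' + 1 = d') ->
     (a * a = b -> a' * a' = b') -> (a * a = c -> a' * a' = c') ->
     (a * a = d -> a' * a' = d') ->
     (a * b = c -> a' * b' = c') -> (a * b = d -> a' * b' = d') ->
     (a * c = d -> a' * c' = d') ->
     (b * b = c -> b' * b' = c') -> (b * b = d -> b' * b' = d') ->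
     (b * c = d -> b' * c' = d') -> (c * c = d -> c' * c' = d') ->
     d' <= 256) ->
  d <= 16.
Proof.
move=> a0 ab bc cd H; case: (leqP d 16) => // d16; exfalso.
(* If [d = c + 1], at most one of [c] and [d] is a product of two smaller values: a common factor
   above 1 and consecutive positive squares are both impossible. *)
case: (eqVneq (c + 1) d) => [cd1|cd1].
  case: (eqVneq (b + 1) c) => [bc1|bc1].
    case: (eqVneq (a + 1) b) => [ab1|ab1].
      by transfer4 H (a + 256) (a + 257) (a + 258) (a + 259).
    if_mul4 a a b H 17 289 290 291.
    if_mul4 a a c H 17 288 289 290.
    if_mul4 a a d H 17 287 288 289.
    by transfer4 H a 257 258 259.
  case: (eqVneq (a + 1) b) => [ab1|ab1].
    if_mul4 a a c H 17 18 289 290.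
    if_mul4 a b c H 17 18 306 307.
    if_mul4 b b c H 17 18 324 325.
    if_mul4 a a d H 17 18 288 289.
    if_mul4 a b d H 17 18 305 306.
    if_mul4 b b d H 17 18 323 324.
    by transfer4 H a b 257 258.
  case: (eqVneq (a * a) b) => ?.
    (* 7 and 5 are the least numbers whose cube and fourth power exceed 256. *)
    if_mul4 a b c H 7 49 343 344.
    if_mul4 b b c H 5 25 625 626.
    if_mul4 a b d H 7 49 342 343.
    if_mul4 b b d H 5 25 624 625.
    by transfer4 H a b 257 258.
  (* No relation joins [a] and [b] any more, so one can keep its value while the other moves. *)
  if_mul4 a a c H 17 b 289 290.
  if_mul4 a b c H a 257 (a * 257) (a * 257 + 1).
  if_mul4 b b c H a 17 289 290.
  if_mul4 a a d H 17 b 288 289.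
  if_mul4 a b d H a 257 (a * 257 - 1) (a * 257).
  if_mul4 b b d H a 17 288 289.
  by transfer4 H a b 257 258.
(* Now [d] can occur only as a product. Each of [a + 1 = b] and [b + 1 = c] excludes
   [a * c = b * b = d], the only possible coincidence, so at most one product equals [d]; if none
   does, [d] is free. *)
case: (eqVneq (a + 1) b) => [ab1|ab1]; case: (eqVneq (b + 1) c) => [bc1|bc1].
- if_mul4 a a d H 17 18 19 289.
  if_mul4 a b d H 17 18 19 306.
  if_mul4 b b d H 17 18 19 324.
  if_mul4 a c d H 17 18 19 323.
  if_mul4 b c d H 17 18 19 342.
  if_mul4 c c d H 17 18 19 361.
  by transfer4 H a b c 257.
- case: (eqVneq (a * a) c) => ?.
    if_mul4 a b d H 17 18 289 306.
    if_mul4 b b d H 17 18 289 324.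
    if_mul4 a c d H 7 8 49 343.
    if_mul4 b c d H 7 8 49 392.
    if_mul4 c c d H 5 6 25 625.
    by transfer4 H a b c 257.
  case: (eqVneq (a * b) c) => ?.
    if_mul4 b b d H 17 18 306 324.
    if_mul4 a c d H 7 8 56 392.
    if_mul4 b c d H 7 8 56 448.
    if_mul4 c c d H 4 5 20 400.
    by transfer4 H a b c 257.
  case: (eqVneq (b * b) c) => ?.
    if_mul4 a c d H 6 7 49 294.
    if_mul4 b c d H 6 7 49 343.
    have aa := @sqr_neq_succ a; if_mul4 c c d H 4 5 25 625.
    by transfer4 H a b c 257.
  (* Here [c] is tied to [a] and [b] by no relation except possibly through [d]. *)
  if_mul4 a a d H 17 18 c 289.
  if_mul4 a b d H 17 18 c 306.
  if_mul4 b b d H 17 18 c 324.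
  if_mul4 a c d H a b 257 (a * 257).
  if_mul4 b c d H a b 257 (b * 257).
  if_mul4 c c d H a b 17 289.
  by transfer4 H a b c 257.
- case: (eqVneq (a * a) b) => ?.
    if_mul4 a b d H 7 49 50 343.
    if_mul4 b b d H 5 25 26 625.
    if_mul4 a c d H 7 49 50 350.
    if_mul4 b c d H 5 25 26 650.
    if_mul4 c c d H 5 25 26 676.
    by transfer4 H a b c 257.
  case: (eqVneq (a * a) c) => ?.
    if_mul4 a b d H 7 48 49 336.
    if_mul4 b b d H 5 24 25 576.
    if_mul4 a c d H 7 48 49 343.
    if_mul4 b c d H 5 24 25 600.
    if_mul4 c c d H 5 24 25 625.
    by transfer4 H a b c 257.
  if_mul4 a a d H 17 b c 289.
  if_mul4 a b d H a 257 258 (a * 257).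
  if_mul4 b b d H a 17 18 289.
  if_mul4 a c d H a 257 258 (a * 258).
  if_mul4 b c d H a 17 18 306.
  if_mul4 c c d H a 17 18 324.
  by transfer4 H a b c 257.
(* Squares suffice here, as [16 ^ 2 = 256]. *)
suff: d ^ 2 <= 256 by move: d16; clear; nia.
by apply: (H (a ^ 2) (b ^ 2) (c ^ 2)); rewrite ?expn_gt0 ?a0 //; lia.
Qed.

(** * From sets of values to chains *)

(** The product clause leaves out factors 1 and the order of the factors, which
    [relations_preservedM] recovers; this shortens the case checks in [chain_bound]. *)
Definition relations_preserved (s : seq nat) (g : nat -> nat) : Prop :=
  [/\ {in s, forall u, 0 < g u}, {in s, forall u, u = 1 -> g u = 1},
      {in s, forall u, u + 1 \in s -> g (u + 1) = g u + 1}
    & {in s &, forall u v, 1 < u -> u <= v -> u * v \in s ->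
         g (u * v) = g u * g v}].

Lemma relations_preservedM s g : relations_preserved s g ->
  {in s &, forall u v, 0 < u -> 0 < v -> u * v \in s -> g (u * v) = g u * g v}.
Proof.
case=> _ g1 _ gM u v us vs u0 v0 uvs.
case: (eqVneq u 1) => [u1|u1].
  by rewrite u1 mul1n in us *; rewrite (g1 1) // mul1n.
case: (eqVneq v 1) => [v1|v1].
  by rewrite v1 muln1 in vs *; rewrite (g1 1) // muln1.
case: (leqP u v) => uv; first by apply: gM => //; lia.
by rewrite mulnC [RHS]mulnC; apply: gM; rewrite 1?mulnC //; lia.
Qed.

Lemma chain_bound n s : 0 < n < 5 -> size s <= n -> sorted ltn s ->
  all (ltn 0) s ->
  (forall g, relations_preserved s g -> {in s, forall u, g u <= 256}) ->
  {in s, forall u, u <= f n}.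
Proof.
(* [f] is nondecreasing on 1, ..., 4, so [n] can be replaced by [size s]. *)
move=> n5; suff E : sorted ltn s -> all (ltn 0) s ->
    (forall g, relations_preserved s g -> {in s, forall u, g u <= 256}) ->
    size s <= 4 -> {in s, forall u, u <= f (size s)}.
  move=> sn ss s0 H u us; have s4 : size s <= 4 by lia.
  have {E ss H s4} := E ss s0 H s4 u us; move: sn n5.
  have {us s0} : 0 < size s by case: s us {s0}.
  move: (size s) n => [|[|[|[|[|m]]]]] [|[|[|[|[|n]]]]] //=; rewrite /f /=; try lia.
  1-3: by move=> _ _ _ /leq_trans; apply.
case: s => [|a [|b [|c [|d [|]]]]] //=.
- move=> _ /andP[a0 _] H _ u; rewrite inE => /eqP->.
  case: (leqP a 1) => // a1; suff: 257 <= 256 by [].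
  (* A single value above 1 satisfies no relation with itself. *)
  apply: (H (fun=> 257)) (mem_head a _); split=> //.
  + by move=> v; rewrite inE => /eqP-> ?; lia.
  + by move=> v; rewrite !inE => /eqP-> /eqP ?; lia.
  + by move=> v w; rewrite !inE => /eqP-> /eqP-> ? ? /eqP ?; nia.
- move=> /andP[ab _] /and3P[a0 _ _] H _.
  suff b2 : b <= 2.
    by move=> u; rewrite !inE => /orP[]/eqP->; apply: (@leq_trans b) => //; lia.
  apply: (@chain2_bound a) => // a' b' a'0 b'0 *.
  pose g u := if u == a then a' else b'.
  have [ga gb] : g a = a' /\ g b = b'.
    by rewrite /g; split; repeat case: eqP => //; clear -ab; lia.
  rewrite -gb; apply: H; last by rewrite !inE eqxx ?orbT.
  move: g ga gb => g ga gb; split.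
  + by move=> u; rewrite !inE => /orP[]/eqP->; rewrite ?ga ?gb.
  + by move=> u; rewrite !inE => /orP[]/eqP-> e; rewrite ?ga ?gb;
      first [by auto | clear -a0 ab e; lia].
  + by move=> u; rewrite !inE => /orP[]/eqP-> /orP[]/eqP e; rewrite e ?ga ?gb;
      first [by symmetry; auto | clear -a0 ab e; lia].
  (* The product lies strictly beyond both factors in the chain, which leaves only the cases listed
     in [chain2_bound]. *)
  + move=> u v us vs u1 uv; have : v < u * v.
      by rewrite ltn_Pmull // (leq_trans (ltnW u1)).
    move: us vs u1 uv; rewrite !inE => /orP[]/eqP-> /orP[]/eqP-> u1 uv uvv
      /orP[]/eqP e; rewrite e ?ga ?gb;
      first [by symmetry; auto | clear -a0 ab u1 uv uvv e; lia].
- move=> /and3P[ab bc _] /and4P[a0 _ _ _] H _.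
  suff c4 : c <= 4.
    by move=> u; rewrite !inE => /or3P[]/eqP->; apply: (@leq_trans c) => //; lia.
  apply: (@chain3_bound a b) => // a' b' c' a'0 b'0 c'0 *.
  pose g u := if u == a then a' else if u == b then b' else c'.
  have [ga gb gc] : [/\ g a = a', g b = b' & g c = c'].
    by rewrite /g; split; repeat case: eqP => //; clear -ab bc; lia.
  rewrite -gc; apply: H; last by rewrite !inE eqxx ?orbT.
  move: g ga gb gc => g ga gb gc; split.
  + by move=> u; rewrite !inE => /or3P[]/eqP->; rewrite ?ga ?gb ?gc.
  + by move=> u; rewrite !inE => /or3P[]/eqP-> e; rewrite ?ga ?gb ?gc;
      first [by auto | clear -a0 ab bc e; lia].
  + by move=> u; rewrite !inE => /or3P[]/eqP-> /or3P[]/eqP e; rewrite e ?ga ?gb ?gc;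
      first [by symmetry; auto | clear -a0 ab bc e; lia].
  + move=> u v us vs u1 uv; have : v < u * v.
      by rewrite ltn_Pmull // (leq_trans (ltnW u1)).
    move: us vs u1 uv; rewrite !inE => /or3P[]/eqP-> /or3P[]/eqP-> u1 uv uvv
      /or3P[]/eqP e; rewrite e ?ga ?gb ?gc;
      first [by symmetry; auto | clear -a0 ab bc u1 uv uvv e; lia].
move=> /and4P[ab bc cd _] /and5P[a0 _ _ _ _] H _.
suff d16 : d <= 16.
  by move=> u; rewrite !inE => /or4P[]/eqP->; apply: (@leq_trans d) => //; lia.
apply: (@chain4_bound a b c) => // a' b' c' d' a'0 b'0 c'0 d'0 *.
pose g u := if u == a then a' else if u == b then b'
              else if u == c then c' else d'.
have [ga gb gc gd] : [/\ g a = a', g b = b', g c = c' & g d = d'].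
  by rewrite /g; split; repeat case: eqP => //; clear -ab bc cd; lia.
rewrite -gd; apply: H; last by rewrite !inE eqxx ?orbT.
move: g ga gb gc gd => g ga gb gc gd; split.
+ by move=> u; rewrite !inE => /or4P[]/eqP->; rewrite ?ga ?gb ?gc ?gd.
+ by move=> u; rewrite !inE => /or4P[]/eqP-> e; rewrite ?ga ?gb ?gc ?gd;
      first [by auto | clear -a0 ab bc cd e; lia].
+ by move=> u; rewrite !inE => /or4P[]/eqP-> /or4P[]/eqP e; rewrite e ?ga ?gb ?gc ?gd;
      first [by symmetry; auto | clear -a0 ab bc cd e; lia].
+ move=> u v us vs u1 uv; have : v < u * v.
      by rewrite ltn_Pmull // (leq_trans (ltnW u1)).
  move: us vs u1 uv; rewrite !inE => /or4P[]/eqP-> /or4P[]/eqP-> u1 uv uvv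
      /or4P[]/eqP e; rewrite e ?ga ?gb ?gc ?gd;
      first [by symmetry; auto | clear -a0 ab bc cd u1 uv uvv e; lia].
Qed.

(** * Large [n] and the conclusion *)

Lemma f_ge256 n : 4 < n -> 256 <= f n.
Proof.
move=> n5; case: (eqVneq n 5) => [-> //|n_neq5].
rewrite /f (_ : (n == 1) = false) 1?(_ : (n <= 5) = false); try lia.
(* For [n >= 6] base and exponent are both at least 4, and [4 ^ 4 = 256]. *)
have e4 : 4 <= 2 ^ (n - 4) by rewrite (leq_pexp2l (m := 2) (n1 := 2)) //; lia.
apply: (@leq_trans (4 ^ 2 ^ (n - 4))).
  by rewrite (leq_pexp2l (m := 4) (n1 := 4)).
by rewrite leq_exp2r ?(leq_add2l 2 2) ?(leq_exp2l 1) ?expn_gt0.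
Qed.

Theorem theorem10 : Phi 256.
Proof.
move=> n T n0 bound x [x0 xT] i.
case: (ltnP 4 n) => [/f_ge256|n4].
  exact/leq_trans/bound.
set s := sort leq (undup (codom x)).
have xs j : x j \in s by rewrite mem_sort mem_undup codom_f.
apply: (@chain_bound n s) => //; first by lia.
- by rewrite size_sort (leq_trans (size_undup _)) // size_codom card_ord.
- rewrite ltn_sorted_uniq_leq sort_uniq undup_uniq sort_sorted //.
  exact: leq_total.
- by apply/allP => u; rewrite mem_sort mem_undup => /codomP[j ->]; exact: x0.
move=> g gs u; rewrite mem_sort mem_undup => /codomP[j ->].
(* Each equation of [T] holds at [x], so it is a relation between entries of [s], and [g] keeps
   it. *)
apply: (bound (g \o x)); split=> [k|e /xT]; have [g0 _ gD _] := gs.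
  exact: g0.
case: e => [k l|k l m] /= e; first by rewrite -e gD // e.
by rewrite -e (relations_preservedM _ _ gs) // e.
Qed.
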